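(* Let $c,\varepsilon>0$ be constants with $c > 2\left(\frac{2}{3\varepsilon}+1\right)^2$. Then $\nu_{c\log n}(n) \le \widetilde{\mathcal{O}}\left(n^{\frac{2}{3}+\varepsilon}\right)$ as $n\to\infty$.
   Context: All graphs are finite, simple and undirected; $A_G$ is the adjacency matrix of $G$, $I$ the identity matrix, rank is over $\mathbb{R}$, and $\omega(G)$ is the clique number. For a real $d>0$ and positive integer $n$, $\nu_d(n)$ is the minimum of $\operatorname{rank}(A_G+I)$ over all graphs $G$ on $n$ vertices with $\omega(G)\le d$. Logarithms are base $2$. $\widetilde{\mathcal{O}}(\cdot)$ denotes $\mathcal{O}(\cdot)$ up to polylogarithmic factors in $n$. *)

(* Defs.v *)
From HB Require Import structures.
From mathcomp Require Import all_boot all_order all_algebra.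
From mathcomp Require Import all_classical all_reals all_analysis.

Set Implicit Arguments.
Unset Strict Implicit.
Unset Printing Implicit Defensive.

Import Order.TTheory GRing.Theory Num.Theory.
Import numFieldNormedType.Exports.

Local Open Scope classical_set_scope.
Local Open Scope ring_scope.

(* A finite simple undirected graph on the vertex set 'I_n is a symmetric
   irreflexive set of ordered pairs. *)
Definition is_sgraph (n : nat) (E : {set 'I_n * 'I_n}) : bool :=
  [forall u, forall v, ((u, v) \in E) ==> ((v, u) \in E)] &&
  [forall u, (u, u) \notin E].

Definition sgraph (n : nat) := {E : {set 'I_n * 'I_n} | is_sgraph E}.

Definition adj (n : nat) (G : sgraph n) : rel 'I_n :=
  fun u v => (u, v) \in val G.

Definition adjmx (R : realType) (n : nat) (G : sgraph n) : 'M[R]_n :=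
  \matrix_(u, v) (adj G u v)%:R.

Definition clique (n : nat) (G : sgraph n) (S : {set 'I_n}) : bool :=
  [forall u in S, forall v in S, (u != v) ==> adj G u v].

Definition clique_number (n : nat) (G : sgraph n) : nat :=
  \max_(S : {set 'I_n} | clique G S) #|S|.

(* The default value n of the iterated minimum bounds every rank in the range,
   so it only matters when no graph satisfies the constraint (n > 0, d < 1);
   see nuP.  The %R matters: \rank parses its argument in the row-space scope
   %MS, where + is the sum of subspaces. *)
Definition nu (R : realType) (d : R) (n : nat) : nat :=
  \big[minn/n]_(G : sgraph n | (clique_number G)%:R <= d)
    \rank (adjmx R G + 1%:M)%R.

Lemma nu_le (R : realType) (d : R) (n : nat) (G : sgraph n) :
  (clique_number G)%:R <= d -> (nu d n <= \rank (adjmx R G + 1%:M)%R)%N.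
Proof.
move=> Gd; rewrite /nu; have := mem_index_enum G.
elim: (index_enum _) => // H r IH; rewrite inE big_cons => /orP[/eqP <-|/IH le].
  by rewrite Gd /= geq_minl.
by case: ifP => // _; rewrite geq_min le orbT.
Qed.

Lemma nuP (R : realType) (d : R) (n : nat) :
  (exists G : sgraph n, (clique_number G)%:R <= d) ->
  exists2 G : sgraph n, (clique_number G)%:R <= d &
    nu d n = \rank (adjmx R G + 1%:M)%R.
Proof.
move=> [G0 G0d].
pose P (G : sgraph n) : bool := (clique_number G)%:R <= d.
have [G Gd Gmin] :=
  @arg_minnP _ G0 P (fun G => \rank (adjmx R G + 1%:M)%R) G0d.
exists G => //; apply/eqP; rewrite eqn_leq nu_le //=.
by rewrite /nu; elim/big_ind: _ => [|x y|//]; rewrite ?rank_leq_row // leq_min => -> ->.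
Qed.

(* ln 0 = 0 in the library; only large n matter below. *)
Definition log2 (R : realType) (n : nat) : R := ln n%:R / ln 2%:R.

Definition is_softO (R : realType) (f g : nat -> R) : Prop :=
  exists k : nat,
    (f : nat -> R^o) =O_\oo ((fun n => g n * log2 R n ^+ k) : nat -> R^o).

Lemma is_softOP (R : realType) (f g : nat -> R) :
  is_softO f g <-> exists (k N : nat) (C : R),
    forall n, (N <= n)%N -> `|f n| <= C * `|g n * log2 R n ^+ k|.
Proof.
split=> [[k /eqO_exP[C C0 [N _ H]]]|[k [N [C H]]]].
  by exists k, N, C => n; exact: H.
exists k; apply/eqO_exP; exists (Num.max C 1); first by rewrite lt_max ltr01 orbT.
exists N => // n /= Nn; apply: le_trans (H n Nn) _.
by rewrite ler_wpM2r // le_max lexx.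
Qed.

(* Main.v *)
(** Let [g] be a graph on the points of a partial linear space and take its
    flags [(p, l)] as vertices.  The symmetric matrix
      [M ((p, l), (p', l')) = g p p' * (1 - [p in l'] - [p' in l]) + [l = l']]
    has 0/1 entries and unit diagonal, because two distinct points lie on at
    most one common line; so it is [A + I] for a graph on the flags.  Each of
    its four terms depends on one of the two flags only through its point or
    only through its line, so its rank is at most three times the number of
    points plus the number of lines.  A clique of size [t] in the flag graph
    has [t] distinct points and prescribes [g] on all pairs of them, so the
    union bound for a uniformly random [g] on [n] flags gives a clique number
    below [2 log n].  The affine plane over a field of order [q = 2^k] has
    [q^3] non-vertical flags on [q^2] points and [q^2] lines, which yields rank
    [O(n^(2/3))]. *)

Require Import Defs.
From HB Require Import structures.
From mathcomp Require Import all_boot all_order all_algebra.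
From mathcomp Require Import all_classical all_reals all_analysis.
From mathcomp Require Import finfield.
From mathcomp Require Import ring lra zify.

Import Order.TTheory GRing.Theory Num.Theory.
Import numFieldNormedType.Exports.

Local Open Scope ring_scope.

(** * Counting estimates for the union bound *)

Lemma bin_fact_le_exp (n t : nat) : ('C(n, t) * t`! <= n ^ t)%N.
Proof.
rewrite bin_ffact; elim: t n => [|t IH] [|n] //.
rewrite ffactnS expnS leq_mul2l /=; apply: leq_trans (IH n) _.
by case: t {IH} => // t; rewrite leq_exp2r.
Qed.

Lemma exp2_lt_fact_sq (t : nat) : (3 <= t)%N -> (2 ^ t < t`! ^ 2)%N.
Proof.
elim: t => // t IH; rewrite leq_eqVlt => /predU1P[[<-]//|t3].
rewrite factS expnMn expnS; have {}IH := IH t3.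
by apply: (@leq_ltn_trans (2 * t`! ^ 2)); nia.
Qed.

(** Since [n ^ t] is at most [2 ^ (t * t / 2)], which is [2 ^ 'C(t, 2)] times [2 ^ (t / 2)],
    dividing by [t!] more than absorbs the last factor. Everything is squared to keep exponents
    integral. *)
Lemma bin_lt_exp2_bin (n t : nat) :
  (3 <= t)%N -> (n ^ 2 <= 2 ^ t)%N -> ('C(n, t) < 2 ^ 'C(t, 2))%N.
Proof.
move=> t3 nt; rewrite -(ltn_exp2r _ _ (ltn0Sn 1)).
have H1 : (('C(n, t) * t`!) ^ 2 <= 2 ^ (t * t))%N.
  apply: (@leq_trans ((n ^ t) ^ 2)); first by rewrite leq_exp2r ?bin_fact_le_exp.
  by rewrite -expnM mulnC expnM expnM leq_exp2r //; lia.
have E : (2 ^ (t * t) = (2 ^ 'C(t, 2)) ^ 2 * 2 ^ t)%N.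
  rewrite -expnM -expnD; congr (2 ^ _)%N.
  by rewrite bin2 muln2 halfK oddM; case: t {H1 nt} t3 => // t _ /=; case: (odd t) => /=; nia.
rewrite E expnMn in H1; have H2 := exp2_lt_fact_sq _ t3.
have e0 : (0 < 2 ^ t)%N by rewrite expn_gt0.
rewrite ltnNge; apply/negP => H3.
have : ((2 ^ 'C(t, 2)) ^ 2 * t`! ^ 2 <= (2 ^ 'C(t, 2)) ^ 2 * 2 ^ t)%N.
  by apply: leq_trans H1; rewrite leq_mul2r H3 orbT.
by rewrite leq_pmul2l ?expn_gt0 // leqNgt H2.
Qed.

(** Values are chosen independently: one choice at each point of [D], two elsewhere. *)
Lemma card_ffun_bool_fixed_on (T : finType) (D : {set T}) (g0 : {ffun T -> bool}) :
  (#|[set g : {ffun T -> bool} | [forall x in D, g x == g0 x]]| * 2 ^ #|D|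
   <= 2 ^ #|T|)%N.
Proof.
pose F x : pred bool := fun b => (x \in D) ==> (b == g0 x).
have -> : #|[set g : {ffun T -> bool} | [forall x in D, g x == g0 x]]|
          = #|family F| by rewrite cardsE; apply: eq_card => g; rewrite !inE.
rewrite card_family foldrE big_map big_enum /= (bigID (mem D)) /= big1; last first.
  move=> x xD; rewrite -(card1 (g0 x)); apply: eq_card => b.
  by rewrite [LHS]unfold_in /F xD.
rewrite mul1n (eq_bigr (fun=> 2%N)); last first.
  move=> x xD; rewrite -card_bool; apply: eq_card => b.
  by rewrite [LHS]unfold_in /F (negbTE xD).
by rewrite prod_nat_const -expnD addnC leq_exp2l // -[#|T|](cardC D).
Qed.

(** * The flag graph and its cliques *)

Section FlagGraph.
Variables (n : nat) (P L : finType) (pt : 'I_n -> P) (line : 'I_n -> L).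
Variable inc : P -> L -> bool.
Hypothesis inc_flag : forall u, inc (pt u) (line u).
Hypothesis flag_inj : forall u v, pt u = pt v -> line u = line v -> u = v.
Hypothesis inc_linear : forall p p' l l',
  inc p l -> inc p' l -> inc p l' -> inc p' l' -> p = p' \/ l = l'.
Implicit Type g : {ffun {set P} -> bool}.

(* The colouring [g] is defined on all sets of points; only pairs matter. *)
Definition ptadj g (p q : P) : bool := (p != q) && g [set p; q].

Lemma ptadjC g : symmetric (ptadj g).
Proof. by move=> p q; rewrite /ptadj eq_sym finset.setUC. Qed.

(** The off-diagonal entries of [M]: on a common line both incidences hold and the entry is [1 - g];
    on distinct lines it is [g] unless one incidence cancels it. *)
Definition flagadj g (u v : 'I_n) : bool :=
  if line u == line v then (u != v) && ~~ ptadj g (pt u) (pt v)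
  else [&& ptadj g (pt u) (pt v), ~~ inc (pt u) (line v) & ~~ inc (pt v) (line u)].

Definition flagedges g : {set 'I_n * 'I_n} := [set uv | flagadj g uv.1 uv.2].

Lemma flagedges_sgraph g : is_sgraph (flagedges g).
Proof.
apply/andP; split; apply/forallP => u; last first.
  by rewrite inE /= /flagadj !eqxx.
apply/forallP => v; apply/implyP; rewrite !inE /= /flagadj.
rewrite (eq_sym (line v)) (eq_sym v) (ptadjC g (pt v)).
by case: ifP => // _; rewrite (andbC (~~ inc (pt v) _)).
Qed.

Definition flaggraph g : sgraph n := exist _ (flagedges g) (flagedges_sgraph g).

Lemma adj_flaggraph g u v : adj (flaggraph g) u v = flagadj g u v.
Proof. by rewrite /adj /= inE. Qed.

Lemma flagadj_pt_neq g u v : u != v -> flagadj g u v -> pt u != pt v.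
Proof.
move=> uv; rewrite /flagadj; case: eqP => [l _|_ /and3P[/andP[]]//].
by apply: contra uv => /eqP p; rewrite (flag_inj _ _ p l).
Qed.

(** Adjacency needs a non-edge of [g] on a common line and an edge on distinct lines, so a clique
    fixes one bit of [g] per pair. *)
Lemma flagadj_determined g u v :
  u != v -> flagadj g u v -> g [set pt u; pt v] = (line u != line v).
Proof.
move=> uv a; have pp := flagadj_pt_neq _ _ _ uv a.
move: a; rewrite /flagadj /ptadj uv pp /=.
by case: eqP => _ /=; [move/negbTE | case/and3P].
Qed.

(** Fix one colouring [g0] making [S] a clique; all others agree with it on the pairs of points of
    [S], and [pt] is injective on [S]. *)
Lemma card_clique_colorings (S : {set 'I_n}) :
  (#|[set g | clique (flaggraph g) S]| * 2 ^ 'C(#|S|, 2) <= 2 ^ #|{set P}|)%N.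
Proof.
have [->|[g0]] := set_0Vmem [set g | clique (flaggraph g) S].
  by rewrite cards0 mul0n.
have cl g u v : clique (flaggraph g) S -> u \in S -> v \in S -> u != v ->
    flagadj g u v.
  move=> /forallP/(_ u)/implyP c uS vS uv; rewrite -adj_flaggraph.
  by move/forallP/(_ v)/implyP: (c uS) => /(_ vS)/implyP/(_ uv).
rewrite inE => g0S.
have ptS : {in S &, injective pt}.
  move=> u v uS vS p; apply/eqP/negPn/negP => uv.
  by have := flagadj_pt_neq _ _ _ uv (cl _ _ _ g0S uS vS uv); rewrite p eqxx.
pose D := [set A : {set P} | A \subset pt @: S & #|A| == 2%N].
have cD : #|D| = 'C(#|S|, 2) by rewrite cards_draws card_in_imset.
apply: leq_trans (card_ffun_bool_fixed_on _ D g0); rewrite cD leq_mul2r.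
apply/orP; right; apply/subset_leq_card/fintype.subsetP => g; rewrite !inE => gS.
apply/forallP => A; apply/implyP; rewrite inE => /andP[AS /cards2P[p [q [pq E]]]].
move: AS; rewrite E finset.subUset !finset.sub1set => /andP[/imsetP[u uS pu] /imsetP[v vS qv]].
have uv : u != v by apply: contra pq => /eqP uv; rewrite pu qv uv.
by rewrite pu qv !flagadj_determined // cl.
Qed.

Lemma exists_flaggraph_clique_lt (t : nat) :
  ('C(n, t) < 2 ^ 'C(t, 2))%N ->
  exists g, (forall S, clique (flaggraph g) S -> (#|S| < t)%N).
Proof.
move=> nt.
pose bad g := [exists S : {set 'I_n}, (#|S| == t) && clique (flaggraph g) S].
have [g ngood|allbad] := pickP (fun g => ~~ bad g).
  exists g => S cS; rewrite ltnNge; apply/negP => tS.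
  (* A larger clique contains a clique of size exactly [t]. *)
  have : (0 < #|[set A : {set 'I_n} | A \subset S & #|A| == t]|)%N.
    by rewrite cards_draws bin_gt0.
  case/card_gt0P => A; rewrite inE => /andP[/fintype.subsetP AS tA].
  case/negP: ngood; apply/existsP; exists A; rewrite tA /=.
  apply/forallP => u; apply/implyP => uA; apply/forallP => v; apply/implyP => vA.
  move/forallP/(_ u)/implyP/(_ (AS _ uA)): cS.
  by move=> /forallP/(_ v)/implyP/(_ (AS _ vA)).
pose K := #|{set P}|.
(* If all colourings are bad, each is counted at least once in this sum. *)
have H1 : (2 ^ K <= \sum_(S : {set 'I_n} | #|S| == t)
                     #|[set g | clique (flaggraph g) S]|)%N.
  have <- : #|{ffun {set P} -> bool}| = (2 ^ K)%N by rewrite card_ffun card_bool.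
  under eq_bigr do rewrite -sum1_card.
  rewrite -sum1_card (exchange_big_dep predT) //=; apply: leq_sum => g _.
  have /negbFE/existsP[S /andP[St cS]] := allbad g.
  by rewrite (bigD1 S) /= ?St ?inE ?cS.
have : (2 ^ K * 2 ^ 'C(t, 2) <= 'C(n, t) * 2 ^ K)%N.
  apply: (@leq_trans ((\sum_(S : {set 'I_n} | #|S| == t)
      #|[set g | clique (flaggraph g) S]|) * 2 ^ 'C(t, 2))).
    by rewrite leq_mul2r H1 orbT.
  rewrite big_distrl /=.
  apply: (@leq_trans (\sum_(S : {set 'I_n} | #|S| == t) 2 ^ K)%N).
    by apply: leq_sum => S /eqP <-; exact: card_clique_colorings.
  by rewrite sum_nat_const -[n in 'C(n, _)]card_ord -card_draws cardsE.
by rewrite mulnC leq_pmul2r ?expn_gt0 // leqNgt nt.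
Qed.

Lemma flaggraph_mxE (R : realType) g :
  adjmx R (flaggraph g) + 1%:M =
  \matrix_(u, v) (ptadj g (pt u) (pt v))%:R
  - \matrix_(u, v) (ptadj g (pt u) (pt v) && inc (pt u) (line v))%:R
  - \matrix_(u, v) (ptadj g (pt u) (pt v) && inc (pt v) (line u))%:R
  + \matrix_(u, v) (line u == line v)%:R.
Proof.
apply/matrixP => u v; rewrite !mxE adj_flaggraph /flagadj.
have [->|uv] := eqVneq u v; first by rewrite /ptadj !eqxx /= !subr0.
have [l|l] := eqVneq (line u) (line v).
  rewrite -l inc_flag l inc_flag /= !andbT.
  by case: ptadj => /=; rewrite ?(subrr, sub0r, subr0, addr0, add0r, addNr).
rewrite !addr0; case p: ptadj => /=; last by rewrite !subr0.
(* Otherwise both points would lie on both lines, forcing equal points or equal lines. *)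
have : ~~ (inc (pt u) (line v) && inc (pt v) (line u)).
  apply/negP => /andP[a b].
  have [pp|/eqP] := inc_linear _ _ _ _ (inc_flag u) b a (inc_flag v).
    by move: p; rewrite /ptadj pp eqxx.
  by rewrite (negbTE l).
by case: (inc _ _); case: (inc _ _) => //= _; rewrite ?subr0 ?subrr.
Qed.

End FlagGraph.

(** * Rank bounds *)

Lemma mxrank_factor_row (K : fieldType) (m n : nat) (X : finType)
    (f : X -> 'I_n -> K) (h : 'I_m -> X) :
  (\rank (\matrix_(u, v) f (h u) v) <= #|X|)%N.
Proof.
suff -> : \matrix_(u, v) f (h u) v =
    (\matrix_(u < m, i < #|X|) (h u == enum_val i)%:R) *m
    (\matrix_(i < #|X|, v < n) f (enum_val i) v).
  exact: mulmx_max_rank.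
apply/matrixP => u v; rewrite !mxE (bigD1 (enum_rank (h u))) //=.
rewrite !mxE enum_rankK eqxx mul1r big1 ?addr0 // => i ih; rewrite !mxE.
case: eqP => [E|_]; last by rewrite mul0r.
by move: ih; rewrite E enum_valK eqxx.
Qed.

Lemma mxrank_factor_col (K : fieldType) (m n : nat) (X : finType)
    (f : 'I_m -> X -> K) (h : 'I_n -> X) :
  (\rank (\matrix_(u, v) f u (h v)) <= #|X|)%N.
Proof.
rewrite -mxrank_tr; apply: leq_trans (mxrank_factor_row _ _ _ _ (fun x u => f u x) h).
by apply/eq_leq; congr (\rank _); apply/matrixP => u v; rewrite !mxE.
Qed.

Lemma mxrankB_le (K : fieldType) (m n : nat) (A B : 'M[K]_(m, n)) :
  (\rank (A - B)%R <= \rank A + \rank B)%N.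
Proof. by apply: leq_trans (mxrank_add _ _) _; rewrite mxrank_opp. Qed.

(** The first two terms factor through [pt u], the third through [pt v], the last through
    [line u]. *)
Lemma rank_flaggraph (R : realType) (n : nat) (P L : finType)
    (pt : 'I_n -> P) (line : 'I_n -> L) (inc : P -> L -> bool)
    (inc_flag : forall u, inc (pt u) (line u))
    (inc_linear : forall p p' l l',
      inc p l -> inc p' l -> inc p l' -> inc p' l' -> p = p' \/ l = l')
    (g : {ffun {set P} -> bool}) :
  (\rank (adjmx R (flaggraph n P L pt line inc g) + 1%:M)%R <= 3 * #|P| + #|L|)%N.
Proof.
rewrite flaggraph_mxE //.
apply: leq_trans (mxrank_add _ _) _; apply: leq_add; last first.
  exact: (mxrank_factor_row _ _ _ _ (fun l v => (l == line v)%:R)).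
rewrite -addn1 mulnDl mul1n.
apply: leq_trans (mxrankB_le _ _ _ _ _) _; apply: leq_add; last first.
  exact: (mxrank_factor_col _ _ _ _ (fun u p => (ptadj P g (pt u) p && inc p (line u))%:R)).
rewrite mul2n -addnn.
apply: leq_trans (mxrankB_le _ _ _ _ _) _; apply: leq_add.
  exact: (mxrank_factor_row _ _ _ _ (fun p v => (ptadj P g p (pt v))%:R)).
exact: (mxrank_factor_row _ _ _ _ (fun p v => (ptadj P g p (pt v) && inc p (line v))%:R)).
Qed.

(** * The affine plane and the choice of parameters *)

Lemma affine_plane_graph (R : realType) (F : finFieldType) (n t : nat) :
  (n <= #|F| ^ 3)%N -> (3 <= t)%N -> (n ^ 2 <= 2 ^ t)%N ->
  exists G : sgraph n, (clique_number G < t)%N /\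
    (\rank (adjmx R G + 1%:M)%R <= 4 * #|F| ^ 2)%N.
Proof.
move=> nF t3 nt.
pose inc (p l : F * F) := p.2 == l.1 * p.1 + l.2.
have cF : #|{: F * F * F}| = (#|F| ^ 3)%N by rewrite !card_prod !expnS expn0 muln1 mulnA.
have nF' : (n <= #|{: F * F * F}|)%N by rewrite cF.
(* A triple [(x, a, b)] encodes the line [y = a * x + b] with its point of abscissa [x]. *)
pose w (u : 'I_n) : F * F * F := enum_val (widen_ord nF' u).
pose pt u := ((w u).1.1, (w u).1.2 * (w u).1.1 + (w u).2).
pose line u := ((w u).1.2, (w u).2).
have inc_flag u : inc (pt u) (line u) by rewrite /inc.
have flag_inj u v : pt u = pt v -> line u = line v -> u = v.
  rewrite /pt /line => -[x _] [a b]; apply: val_inj.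
  have /enum_val_inj/(congr1 val) // : w u = w v.
  by move: x a b; case: (w u) => [[? ?] ?]; case: (w v) => [[? ?] ?] /= -> -> ->.
have inc_linear p p' l l' :
    inc p l -> inc p' l -> inc p l' -> inc p' l' -> p = p' \/ l = l'.
  case: p p' l l' => [x y] [x' y'] [a b] [a' b']; rewrite /inc /=.
  move=> /eqP e1 /eqP e2 /eqP e3 /eqP e4.
  have : (a - a') * (x - x') == 0.
    apply/eqP; transitivity ((a * x + b) - (a' * x + b') - ((a * x' + b) - (a' * x' + b'))).
      by ring.
    by rewrite -e1 -e2 -e3 -e4; ring.
  rewrite mulf_eq0 !subr_eq0 => /orP[/eqP aa|/eqP xx].
    right; congr pair => //; apply: (@addrI _ (a * x)).
    by rewrite -e1 e3 aa.
  by left; rewrite e1 e2 xx.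
have [g gt] := exists_flaggraph_clique_lt _ _ _ pt line inc flag_inj _
  (bin_lt_exp2_bin _ _ t3 nt).
exists (flaggraph n _ _ pt line inc g); split.
  rewrite /clique_number; elim/big_ind: _ => [|x y|S]; first by lia.
    by rewrite gtn_max => -> ->.
  exact: gt.
apply: leq_trans (rank_flaggraph _ _ _ _ _ _ _ inc_flag inc_linear g) _.
by rewrite card_prod -mulnn -mulSnr.
Qed.

Lemma nu_le_exp (R : realType) (d : R) (n : nat) :
  (3 <= n)%N -> 2 * log2 R n <= d ->
  (nu d n)%:R <= 16 * n%:R `^ (2 / 3) :> R.
Proof.
move=> n3 hd.
have n1 : (1 < n)%N by lia.
(* For [q = 2 ^ k] this gives [n <= q ^ 3], while [8 ^ k.-1 < n] bounds [4 * q ^ 2 = 16 * 4 ^ k.-1];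
   hence the constant 16. *)
pose k := up_log 8 n.
have k0 : (0 < k)%N by rewrite up_log_gt0 n1.
have [F _ cF] := pPrimePowerField (isT : prime 2) k0.
have /andP[k1 k2] : (8 ^ k.-1 < n <= 8 ^ k)%N by exact: up_log_bounds.
(* By minimality [t.-1] is below [2 * log2 R n], and cliques have size at most [t.-1]. *)
pose t := up_log 2 (n ^ 2).
have n21 : (1 < n ^ 2)%N by nia.
have /andP[t1 t2] : (2 ^ t.-1 < n ^ 2 <= 2 ^ t)%N by exact: up_log_bounds.
have t3 : (3 <= t)%N.
  rewrite ltnNge; apply/negP => t3.
  have : (2 ^ t <= 2 ^ 2)%N by rewrite leq_exp2l.
  by nia.
have nF : (n <= #|F| ^ 3)%N by rewrite cF -expnM mulnC expnM.
have [G [Gt Gr]] := affine_plane_graph R F n t nF t3 t2.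
have ln2 : 0 < ln 2%:R :> R by rewrite ln_gt0 // ltr1n.
have Gd : (clique_number G)%:R <= d.
  apply: le_trans hd; apply: (@le_trans _ _ t.-1%:R).
    by rewrite ler_nat; lia.
  rewrite /log2 mulrA ler_pdivlMr // mulr_natl mulr_natl -!lnXn ?ltr0n; try lia.
  rewrite ler_ln ?posrE ?exprn_gt0 ?ltr0n; try lia.
  by rewrite -!natrX ler_nat ltnW.
(* Cubing reduces this to [(8 ^ k.-1) ^ 2 <= n ^ 2]. *)
have X : (4 ^ k.-1)%:R <= n%:R `^ (2 / 3) :> R.
  rewrite -(@ler_pXn2r _ 3) ?nnegrE ?ler0n ?powR_ge0 //.
  rewrite -[leRHS]powR_mulrn ?powR_ge0 // -powRrM.
  have -> : 2 / 3 * 3%:R = 2%:R :> R by field.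
  rewrite powR_mulrn ?ler0n // -!natrX ler_nat -expnM mulnC expnM.
  have -> : (4 ^ 3 = 8 ^ 2)%N by [].
  by rewrite -expnM mulnC expnM leq_exp2r // ltnW.
apply: (@le_trans _ _ (16 * (4 ^ k.-1)%:R)); last by rewrite ler_pM2l.
rewrite -natrM ler_nat; apply: leq_trans (nu_le Gd) _.
apply: leq_trans Gr _; rewrite cF -expnM (mulnC k) expnM -(prednK k0) expnS /=.
by rewrite mulnA.
Qed.

Theorem theorem5p1 (R : realType) (c eps : R) (hc : 0 < c) (heps : 0 < eps)
  (hceps : 2 * (2 / (3 * eps) + 1) ^+ 2 < c) :
  is_softO (fun n : nat => (nu (c * log2 R n) n)%:R)
           (fun n : nat => n%:R `^ (2 / 3 + eps)).
Proof.
(* The square in [hceps] exceeds 1, so the clique bound [2 * log2 R n] is within [c * log2 R n]. *)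
have c2 : 2 <= c.
  have : 0 < 2 / (3 * eps) by rewrite divr_gt0 // mulr_gt0.
  by move: (2 / _) hceps => x; nra.
apply/is_softOP; exists 0%N, 3%N, 16 => n n3.
rewrite expr0 mulr1 !ger0_norm ?powR_ge0 //.
apply: le_trans (nu_le_exp _ _ _ n3 _) _.
  by rewrite ler_wpM2r // divr_ge0 // ln_ge0 // ler1n; lia.
rewrite ler_pM2l //; apply: ler_powR; first by rewrite ler1n; lia.
by rewrite lerDl ltW.
Qed.
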